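(* Let $R$ be a commutative ring with identity. For $(a,b,c,d)\in Um(R^4)$ the following properties hold: (1) The matrix $\begin{bmatrix} a & b\\ c & d\end{bmatrix}$ is extendable if and only if there exists $(e,f)\in R^2$ such that $(ae+cf,be+df,ad-bc)\in Um(R^3)$. (2) The matrix $\begin{bmatrix} a & b\\ c & d\end{bmatrix}$ is simply extendable if and only if there exists $(e,f)\in Um(R^2)$ such that $(ae+cf,be+df,ad-bc)\in Um(R^3)$.
   Context: $Um(R^n)$ is the set of $n$-tuples in $R^n$ whose entries generate the unit ideal of $R$. A matrix $A\in\mathbb{M}_2(R)$ is extendable if there exists $A^+\in SL_3(R)$ whose upper-left $2\times 2$ block is $A$; it is simply extendable if moreover $A^+$ can be chosen with $(3,3)$ entry $0$. *)

(* Defs.v *)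
From mathcomp Require Import all_boot all_algebra.

Set Implicit Arguments.
Unset Strict Implicit.
Unset Printing Implicit Defensive.

Import GRing.Theory.
Local Open Scope ring_scope.

(* Rings are [comPzRingType]: the zero ring is allowed. *)

Definition generated_ideal (R : comPzRingType) (n : nat) (v : n.-tuple R)
    (x : R) : Prop :=
  exists r : n.-tuple R, x = \sum_(i < n) tnth r i * tnth v i.

Definition Um (R : comPzRingType) (n : nat) (v : n.-tuple R) : Prop :=
  forall x : R, generated_ideal v x.

Definition SL (R : comPzRingType) (n : nat) (A : 'M[R]_n) : Prop := \det A = 1.

Definition mx22 (R : comPzRingType) (a b c d : R) : 'M[R]_2 :=
  \matrix_(i < 2, j < 2) nth 0 (nth [::] [:: [:: a; b]; [:: c; d]] i) j.

(* [B : 'M_(2 + 1)] is a 3 x 3 matrix whose type exposes its block structure. *)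
Definition extendable (R : comPzRingType) (A : 'M[R]_2) : Prop :=
  exists B : 'M[R]_(2 + 1), SL B /\ ulsubmx B = A.

Definition simply_extendable (R : comPzRingType) (A : 'M[R]_2) : Prop :=
  exists B : 'M[R]_(2 + 1), [/\ SL B, ulsubmx B = A & B ord_max ord_max = 0].

(* Main.v *)
Require Import Defs.
From mathcomp Require Import all_boot all_algebra.
From mathcomp Require Import ring.

Set Implicit Arguments.
Unset Strict Implicit.
Unset Printing Implicit Defensive.

Import GRing.Theory.
Local Open Scope ring_scope.

(** A 3 x 3 matrix with upper-left block [[a, b], [c, d]], last column (x, y, u)
    and last row (z, w, u) has determinant
      u * (a * d - b * c) + z * (b * e + d * f) - w * (a * e + c * f)
    where (e, f) = (y, - x) (see [det_bordered]). Choosing the last column of an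
    extension is thus choosing (e, f), and choosing its last row is choosing
    coefficients that express 1 in terms of p = a * e + c * f, q = b * e + d * f
    and the determinant D = a * d - b * c. This gives the first equivalence, and
    shows that [[a, b], [c, d]] is simply extendable if and only if (p, q) is
    unimodular for some (e, f). In that case (e, f) is itself unimodular, as p and
    q are combinations of e and f. Conversely, (p, q) is the row (e, f) times
    [[a, b], [c, d]], so multiplying by the adjugate matrix shows that D * e and
    D * f lie in the ideal (p, q); if (e, f) is unimodular then so does D, and
    unimodularity of (p, q, D) yields that of (p, q). *)

Lemma Um2P (R : comPzRingType) (p q : R) :
  Um [tuple p; q] <-> exists s t : R, s * p + t * q = 1.
Proof.
split=> [/(_ 1) [r]|[s [t st1]] x].
  rewrite !big_ord_recl big_ord0 /= addr0 => e1.
  by exists (tnth r ord0), (tnth r (lift ord0 ord0)).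
exists [tuple x * s; x * t].
rewrite !big_ord_recl big_ord0 /= addr0 /tnth /=.
by rewrite -!mulrA -mulrDr st1 mulr1.
Qed.

Lemma Um3P (R : comPzRingType) (p q m : R) :
  Um [tuple p; q; m] <-> exists s t u : R, s * p + t * q + u * m = 1.
Proof.
split=> [/(_ 1) [r]|[s [t [u stu1]]] x].
  rewrite !big_ord_recl big_ord0 /= addr0 addrA => e1.
  by exists (tnth r ord0), (tnth r (lift ord0 ord0)),
    (tnth r (lift ord0 (lift ord0 ord0))).
exists [tuple x * s; x * t; x * u].
rewrite !big_ord_recl big_ord0 /= addr0 addrA /tnth /=.
by rewrite -!mulrA -!mulrDr stu1 mulr1.
Qed.

(** The matrix with rows (a, b, x), (c, d, y), (z, w, u). *)
Definition bordered_mx (R : comPzRingType) (a b c d x y z w u : R) :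
    'M[R]_(2 + 1) :=
  \matrix_(i, j)
    nth 0 (nth [::] [:: [:: a; b; x]; [:: c; d; y]; [:: z; w; u]] i) j.

Lemma ulsubmx_bordered (R : comPzRingType) (a b c d x y z w u : R) :
  ulsubmx (bordered_mx a b c d x y z w u) = mx22 a b c d.
Proof.
apply/matrixP=> i j; rewrite !mxE /=.
by case: i j => [[|[|//]] ?] [[|[|//]] ?].
Qed.

Lemma borderedP (R : comPzRingType) (a b c d : R) (B : 'M[R]_(2 + 1)) :
  ulsubmx B = mx22 a b c d ->
  exists x y z w : R, B = bordered_mx a b c d x y z w (B ord_max ord_max).
Proof.
move=> /matrixP BA.
pose k (i : 'I_2) : 'I_(2 + 1) := lshift 1 i.
exists (B (k ord0) ord_max), (B (k ord_max) ord_max),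
  (B ord_max (k ord0)), (B ord_max (k ord_max)).
have {}BA (i j : 'I_2) : B (k i) (k j) = mx22 a b c d i j by rewrite -BA !mxE.
have kE (i : 'I_(2 + 1)) : [\/ i = k ord0, i = k ord_max | i = ord_max].
  by case: i => [[|[|[|//]]] ?]; [constructor 1|constructor 2|constructor 3];
    apply: val_inj.
apply/matrixP=> i j; rewrite [RHS]mxE.
by case: (kE i) (kE j) => -> [] -> //=; rewrite BA mxE.
Qed.

Lemma det_bordered (R : comPzRingType) (a b c d x y z w u : R) :
  \det (bordered_mx a b c d x y z w u) =
  u * (a * d - b * c) + z * (b * y + d * - x) - w * (a * y + c * - x).
Proof.
rewrite (expand_det_row _ ord0) !big_ord_recl big_ord0 /cofactor.
rewrite !(expand_det_row _ ord0) !big_ord_recl !big_ord0 /cofactor !det_mx11.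
by rewrite !mxE /=; ring.
Qed.

Lemma extendableP (R : comPzRingType) (a b c d : R) :
  extendable (mx22 a b c d) <->
  exists e f : R, Um [tuple a * e + c * f; b * e + d * f; a * d - b * c].
Proof.
split=> [[B [detB ulB]]|[e [f /Um3P [s [t [u stu1]]]]]].
  have [x [y [z [w defB]]]] := borderedP ulB.
  exists y, (- x); apply/Um3P; exists (- w), z, (B ord_max ord_max).
  by rewrite -[RHS]detB defB det_bordered -defB; ring.
exists (bordered_mx a b c d (- f) e t (- s) u).
split; last exact: ulsubmx_bordered.
by rewrite /SL det_bordered -stu1; ring.
Qed.

Lemma simply_extendableP (R : comPzRingType) (a b c d : R) :
  simply_extendable (mx22 a b c d) <->
  exists e f : R, Um [tuple a * e + c * f; b * e + d * f].
Proof.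
split=> [[B [detB ulB B0]]|[e [f /Um2P [s [t st1]]]]].
  have [x [y [z [w defB]]]] := borderedP ulB.
  exists y, (- x); apply/Um2P; exists (- w), z.
  by rewrite -[RHS]detB defB det_bordered B0; ring.
exists (bordered_mx a b c d (- f) e t (- s) 0).
split; [|exact: ulsubmx_bordered|by rewrite mxE].
by rewrite /SL det_bordered -st1; ring.
Qed.

Lemma Um_row_mulP (R : comPzRingType) (a b c d e f : R) :
  Um [tuple a * e + c * f; b * e + d * f] <->
  Um [tuple e; f] /\
    Um [tuple a * e + c * f; b * e + d * f; a * d - b * c].
Proof.
split=> [/Um2P [s [t st1]]|[/Um2P [s [t st1]] /Um3P [l [m [n lmn1]]]]].
  split; first by apply/Um2P; exists (s * a + t * b), (s * c + t * d);
    rewrite -[RHS]st1; ring.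
  by apply/Um3P; exists s, t, 0; rewrite mul0r addr0.
(* With p and q the first two entries and D the determinant, the adjugate gives
   D * e = d * p - c * q and D * f = a * q - b * p, so that
   D = s * (D * e) + t * (D * f) is a combination of p and q. *)
apply/Um2P; exists (l + n * (s * d - t * b)), (m + n * (t * a - s * c)).
rewrite -[RHS]lmn1 -[a * d - b * c in RHS]mulr1 -st1; ring.
Qed.

Theorem corollary4p7 (R : comPzRingType) (a b c d : R)
    (habcd : Um [tuple a; b; c; d]) :
  (extendable (mx22 a b c d) <->
     exists e f : R,
       Um [tuple a * e + c * f; b * e + d * f; a * d - b * c])
  /\
  (simply_extendable (mx22 a b c d) <->
     exists e f : R,
       Um [tuple e; f] /\
       Um [tuple a * e + c * f; b * e + d * f; a * d - b * c]).
Proof.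
split; first exact: extendableP.
split=> [/simply_extendableP [e [f /Um_row_mulP ef]]|[e [f /Um_row_mulP ef]]].
  by exists e, f.
by apply/simply_extendableP; exists e, f.
Qed.
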